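(* Let $R$ be a unital ring with involution and let $a\in R$ be Moore-Penrose invertible with Moore-Penrose inverse $a^\dagger$. Then the following are equivalent: (1) $a$ is an EP element; (2) there exists a unit $u\in R$ such that $a^\dagger=ua$; (3) there exists a left invertible element $v\in R$ such that $a^\dagger=va$.
   Context: A unital (associative, not necessarily commutative) ring with involution is a unital ring $R$ with a map $a\mapsto a^*$ satisfying $(a^* )^*=a$, $(ab)^*=b^*a^*$, $(a+b)^*=a^*+b^*$ for all $a,b\in R$. The Moore-Penrose inverse of $a\in R$ is the element $a^\dagger=x$ (unique if it exists) with $axa=a$, $xax=x$, $(ax)^*=ax$, $(xa)^*=xa$; the group inverse of $a$ is the element $a^\#=x$ (unique if it exists) with $axa=a$, $xax=x$, $ax=xa$. An element $a\in R$ is EP if it is both Moore-Penrose invertible and group invertible and $a^\dagger=a^\#$. An element $v$ is left invertible if $tv=1$ for some $t\in R$. *)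

(* Defs.v *)
From mathcomp Require Import all_boot all_algebra.

Set Implicit Arguments.
Unset Strict Implicit.
Unset Printing Implicit Defensive.

Import GRing.Theory.
Local Open Scope ring_scope.

(* Rings are [pzRingType]s: unital, associative, not necessarily commutative,
   with the zero ring allowed. *)

Definition ring_involution (R : pzRingType) (star : R -> R) : Prop :=
  [/\ forall a, star (star a) = a,
      forall a b, star (a * b) = star b * star a
    & forall a b, star (a + b) = star a + star b].

Definition moore_penrose_inverse (R : pzRingType) (star : R -> R) (a x : R)
    : Prop :=
  [/\ a * x * a = a, x * a * x = x, star (a * x) = a * x
    & star (x * a) = x * a].

Definition group_inverse (R : pzRingType) (a x : R) : Prop :=
  [/\ a * x * a = a, x * a * x = x & a * x = x * a].

(* Both inverses are unique when they exist, so the existentials below name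
   the Moore-Penrose inverse x and the group inverse y of a. *)
Definition EP (R : pzRingType) (star : R -> R) (a : R) : Prop :=
  exists x y : R,
    [/\ moore_penrose_inverse star a x, group_inverse a y & x = y].

Definition left_invertible (R : pzRingType) (v : R) : Prop :=
  exists t : R, t * v = 1.

(* [GRing.unit] is only available on [unitRingType], which excludes the zero
   ring and asks for a chosen inverse function and a boolean unit predicate;
   this is the characterization of units in [GRing.unitrP]. *)
Definition is_unit (R : pzRingType) (u : R) : Prop :=
  exists w : R, w * u = 1 /\ u * w = 1.

(* Main.v *)
Require Import Defs.
From mathcomp Require Import all_boot all_algebra.
Import GRing.Theory.
Local Open Scope ring_scope.

(** Write x for the Moore-Penrose inverse of a.  Both a x and x a are
    self-adjoint idempotents, and a is EP exactly when they coincide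
    ([EP_commute], [commute_EP]).

    If a x = x a = p, then a and x are mutually inverse in the corner ring p R p
    and vanish on 1 - p, so x ^+ 2 + (1 - p) is a unit that carries a to x
    ([corner_complement_inverse]).

    Conversely, x = v a with t v = 1 also gives a = t x, so a and x are left
    multiples of each other.  Hence x is fixed by right multiplication by x a,
    and a by right multiplication by a x, which makes each of the idempotents
    a x and x a absorb the other on the right.  Applying the involution turns
    one of these absorptions around, and the two idempotents are equal
    ([left_multiples_commute]). *)

(** The involution reverses the product and fixes both sides.  This is how
    one-sided absorption between projections becomes two-sided. *)
Lemma selfadjoint_mul_swap (R : pzRingType) (star : R -> R) (p q r : R) :
  ring_involution star ->
  star p = p -> star q = q -> star r = r -> p * q = r -> q * p = r.
Proof.
move=> [_ starM _] sp sq sr pq.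
by rewrite -sr -pq starM sp sq.
Qed.

(** The range projections a x and a y absorb each other on the left, the support
    projections x a and y a on the right, so each pair coincides; and
    x = (x a) x = x (a x) recovers x from the two.  In the equivalence this
    identifies the given Moore-Penrose inverse with the one hidden in [EP]. *)
Lemma moore_penrose_inverse_unique (R : pzRingType) (star : R -> R)
    (a x y : R) :
  ring_involution star ->
  moore_penrose_inverse star a x -> moore_penrose_inverse star a y -> x = y.
Proof.
move=> star_inv [axa xax sax sxa] [aya yay say sya].
have eq_ax : a * x = a * y.
  have ayax : a * y * (a * x) = a * x by rewrite mulrA aya.
  rewrite -(selfadjoint_mul_swap _ _ _ _ _ star_inv say sax sax ayax).
  by rewrite mulrA axa.
have eq_xa : x * a = y * a.
  have xaya : x * a * (y * a) = x * a by rewrite -mulrA (mulrA a) aya.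
  rewrite -(selfadjoint_mul_swap _ _ _ _ _ star_inv sxa sya sxa xaya).
  by rewrite -mulrA (mulrA a) axa.
by rewrite -xax eq_xa -mulrA eq_ax mulrA.
Qed.

Lemma EP_commute (R : pzRingType) (star : R -> R) (a x : R) :
  ring_involution star ->
  moore_penrose_inverse star a x -> EP star a -> a * x = x * a.
Proof.
move=> star_inv mpx [y [z [mpy [_ _ az] eq_yz]]].
by rewrite (moore_penrose_inverse_unique _ _ _ _ _ star_inv mpx mpy) eq_yz.
Qed.

Lemma commute_EP (R : pzRingType) (star : R -> R) (a x : R) :
  moore_penrose_inverse star a x -> a * x = x * a -> EP star a.
Proof. by move=> mpx ax; exists x, x; split=> //; case: mpx. Qed.

(** Being left multiples of each other, a and x have the same right annihilator,
    and that is the kernel of both projections x a and a x; an orthogonal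
    projection is determined by its kernel. *)
Lemma left_multiples_commute (R : pzRingType) (star : R -> R) (a x s t : R) :
  ring_involution star ->
  moore_penrose_inverse star a x -> x = s * a -> a = t * x -> a * x = x * a.
Proof.
move=> star_inv [axa xax sax sxa] xE aE.
have xxa : x * (x * a) = x by rewrite {1}xE -mulrA (mulrA a) axa -xE.
have aax : a * (a * x) = a by rewrite {1}aE -mulrA (mulrA x) xax -aE.
have pq : a * x * (x * a) = a * x by rewrite -mulrA xxa.
rewrite -(selfadjoint_mul_swap _ _ _ _ _ star_inv sax sxa sax pq).
by rewrite -mulrA aax.
Qed.

(** The two factors are block diagonal for 1 = a x + (1 - a x): the squares of
    x and a are inverse to each other on the first block, and both factors are
    the identity on the second.  The hypotheses are symmetric in a and x, so
    exchanging them gives the product in the other order. *)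
Lemma corner_complement_inverse (R : pzRingType) (a x : R) :
  group_inverse a x ->
  (x * x + (1 - a * x)) * (a * a + (1 - a * x)) = 1.
Proof.
move=> [axa xax ax].
have xxaa : x * x * (a * a) = a * x.
  by rewrite -mulrA (mulrA x a) -ax axa.
have xx_compl : x * x * (1 - a * x) = 0.
  by rewrite mulrBr mulr1 -mulrA (mulrA x a) xax subrr.
have compl_aa : (1 - a * x) * (a * a) = 0.
  by rewrite mulrBl mul1r mulrA axa subrr.
have compl_idem : (1 - a * x) * (1 - a * x) = 1 - a * x.
  by rewrite mulrBr mulr1 mulrBl mul1r mulrA axa subrr subr0.
rewrite mulrDl mulrDr xxaa xx_compl addr0.
by rewrite mulrDr compl_aa compl_idem add0r addrC subrK.
Qed.

Lemma group_inverse_sym (R : pzRingType) (a x : R) :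
  group_inverse a x -> group_inverse x a.
Proof. by case. Qed.

(** On the corner, a is carried to its inverse x by x ^+ 2; adding the
    complementary idempotent, which kills a, turns this multiplier into a unit
    without changing the product. *)
Lemma group_inverse_unit_multiple (R : pzRingType) (a x : R) :
  group_inverse a x -> exists u : R, is_unit u /\ x = u * a.
Proof.
move=> gx; have [axa xax ax] := gx.
exists (x * x + (1 - a * x)); split.
  exists (a * a + (1 - a * x)); split; last exact: corner_complement_inverse.
  by rewrite ax; apply/corner_complement_inverse/group_inverse_sym.
by rewrite mulrDl mulrBl mul1r axa subrr addr0 -mulrA -ax mulrA xax.
Qed.

Theorem theorem4p4 (R : pzRingType) (star : R -> R)
    (star_inv : ring_involution star) (a adag : R)
    (a_mp : moore_penrose_inverse star a adag) :
  [<-> EP star a;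
       exists u : R, is_unit u /\ adag = u * a;
       exists v : R, left_invertible v /\ adag = v * a].
Proof.
tfae.
- move=> /(EP_commute _ _ _ _ star_inv a_mp) ax.
  by apply: group_inverse_unit_multiple; case: a_mp.
- by move=> [u [[w [wu _]] uE]]; exists u; split=> //; exists w.
- move=> [v [[t tv] vE]]; apply: (commute_EP _ _ _ _ a_mp).
  apply: (left_multiples_commute _ _ _ _ v t star_inv a_mp vE).
  by rewrite vE mulrA tv mul1r.
Qed.
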